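(* Let $l$ be a Pasch space such that every closed line segment of $l$ is connected. Then $l$ is a line if and only if its boundary at infinity $\partial(l,A)$ at some point $A\in l$ consists of two points.
   Context: A betweenness relation on a set $\Pi$ is a ternary relation ''$C$ is between $A$ and $B$'' such that, writing $s[A,B]$ for the set of all points between $A$ and $B$: (a) each point is between itself and any point of $\Pi$; (b) if $A$ is between $B$ and $C$, then $A$ is between $C$ and $B$; (c) if $C\in s[A,B]$, then $s[A,B]=s[A,C]\cup s[C,B]$ and $s[A,C]\cap s[C,B]=s[C,C]=\{C\}$. A closed line segment is a set of the form $s[A,B]$; its interior is $s(A,B)=s[A,B]\setminus\{A,B\}$. A subset $S$ is convex if $s[A,B]\subset S$ for all $A,B\in S$. A closed line segment is connected if, whenever it is expressed as a union of two disjoint non-empty convex subsets, precisely one of them is a closed line segment. A line is a set $l$ with a betweenness relation, consisting of at least two points, such that for every $A\in l$ the complement $l\setminus\{A\}$ is the union of two disjoint non-empty convex sets $c_1,c_2$ with $A\in s[B,C]$ whenever $B\in c_1$, $C\in c_2$. A ray emanating from $A$ is a convex set $r$ such that: $A\in r$ but $A$ is not between any two other points of $r$; every three points of $r$ are contained in a closed line segment which is a subset of $r$; $r$ is not equal to any closed line segment. It is maximal if it is not a proper subset of another ray emanating from $A$, and connected if the closed line segments contained in it are connected. A space with maximal rays is a set with betweenness such that (1) if $s[A,B]$ and $s[A,C]$ have a common interior point, then one of them is contained in the other; (2) if $A\neq B$ and $s[A,B]$ is connected, then there is a connected $s[C,D]$ with $s[A,B]\subset s(C,D)$. Two maximal rays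 $r_1,r_2$ emanating from the same point $A$ are antipodal if there are $B\in r_1$, $C\in r_2$ with $A\in s(B,C)$. The boundary at infinity $\partial(\Pi,A)$ is the set of connected maximal rays emanating from $A$. A Pasch space is a space $\Pi$ with maximal rays satisfying the Pasch Condition: for every $A\in\Pi$ and every subset $\{r_1,r_2,r_3\}$ of $\partial(\Pi,A)$ disjoint from the set of its antipodal rays, and all points $B,C\in r_1\setminus\{A\}$ and $D\in r_3\setminus\{A\}$, if $r_2$ intersects $s[B,D]$ then $r_2$ intersects $s[C,D]$. *)

(* Defs.v *)
From mathcomp Require Import ssreflect ssrfun ssrbool.
From mathcomp Require Import boolp classical_sets.
Set Implicit Arguments.
Unset Strict Implicit.
Unset Printing Implicit Defensive.

Local Open Scope classical_set_scope.

Section BetweennessSpaces.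

Variable Pi : Type.
(* [between C A B] reads "C is between A and B". *)
Variable between : Pi -> Pi -> Pi -> Prop.

Definition seg (A B : Pi) : set Pi := [set C | between C A B].

Definition seg_interior (A B : Pi) : set Pi := seg A B `\` [set A; B].

Record is_betweenness : Prop := IsBetweenness {
  between_endpoint : forall A B : Pi, between A A B;
  between_sym : forall A B C : Pi, between A B C -> between A C B;
  seg_split : forall A B C : Pi, seg A B C ->
    seg A B = seg A C `|` seg C B /\
    seg A C `&` seg C B = seg C C /\ seg C C = [set C]
}.

(* Degenerate segments [seg A A] are allowed. *)
Definition is_closed_segment (S : set Pi) : Prop :=
  exists A B : Pi, S = seg A B.

Definition is_convex (S : set Pi) : Prop :=
  forall A B : Pi, S A -> S B -> seg A B `<=` S.

Definition connected_segment (S : set Pi) : Prop :=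
  is_closed_segment S /\
  forall X Y : set Pi,
    S = X `|` Y -> X `&` Y = set0 -> X !=set0 -> Y !=set0 ->
    is_convex X -> is_convex Y ->
    (is_closed_segment X /\ ~ is_closed_segment Y) \/
    (~ is_closed_segment X /\ is_closed_segment Y).

Record is_line : Prop := IsLine {
  line_betweenness : is_betweenness;
  line_two_points : exists A B : Pi, A <> B;
  line_separation : forall A : Pi, exists c1 c2 : set Pi,
    ~` [set A] = c1 `|` c2 /\ c1 `&` c2 = set0 /\
    c1 !=set0 /\ c2 !=set0 /\ is_convex c1 /\ is_convex c2 /\
    forall B C : Pi, c1 B -> c2 C -> seg B C A
}.

Record is_ray (A : Pi) (r : set Pi) : Prop := IsRay {
  ray_convex : is_convex r;
  ray_origin : r A;
  ray_origin_extreme : forall B C : Pi,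
    r B -> r C -> B <> A -> C <> A -> ~ between A B C;
  ray_three_points : forall B C D : Pi, r B -> r C -> r D ->
    exists E F : Pi, [set B; C; D] `<=` seg E F /\ seg E F `<=` r;
  ray_not_segment : ~ is_closed_segment r
}.

Definition is_maximal_ray (A : Pi) (r : set Pi) : Prop :=
  is_ray A r /\ forall r' : set Pi, is_ray A r' -> ~ r `<` r'.

Definition is_connected_ray (r : set Pi) : Prop :=
  forall S : set Pi, is_closed_segment S -> S `<=` r -> connected_segment S.

Record has_maximal_rays : Prop := HasMaximalRays {
  mr_betweenness : is_betweenness;
  mr_nested : forall A B C : Pi,
    (seg_interior A B `&` seg_interior A C) !=set0 ->
    seg A B `<=` seg A C \/ seg A C `<=` seg A B;
  mr_extension : forall A B : Pi, A <> B -> connected_segment (seg A B) ->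
    exists C D : Pi,
      connected_segment (seg C D) /\ seg A B `<=` seg_interior C D
}.

Definition antipodal (A : Pi) (r1 r2 : set Pi) : Prop :=
  is_maximal_ray A r1 /\ is_maximal_ray A r2 /\
  exists B C : Pi, r1 B /\ r2 C /\ seg_interior B C A.

Definition boundary_at_infinity (A : Pi) : set (set Pi) :=
  [set r | is_maximal_ray A r /\ is_connected_ray r].

Definition antipodal_rays (A : Pi) (R : set (set Pi)) : set (set Pi) :=
  [set r' | exists2 r, R r & antipodal A r r'].

Definition pasch_condition : Prop :=
  forall (A : Pi) (r1 r2 r3 : set Pi),
    [set r1; r2; r3] `<=` boundary_at_infinity A ->
    [set r1; r2; r3] `&` antipodal_rays A [set r1; r2; r3] = set0 ->
    forall B C D : Pi,
      (r1 `\` [set A]) B -> (r1 `\` [set A]) C -> (r3 `\` [set A]) D ->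
      (r2 `&` seg B D) !=set0 -> (r2 `&` seg C D) !=set0.

Definition is_pasch_space : Prop := has_maximal_rays /\ pasch_condition.

End BetweennessSpaces.

(* Main.v *)
(** Write [ray A B] for the set of points comparable to [B] in the order seen
    from [A].  The maximal rays emanating from [A] are exactly these sets, so
    the boundary at [A] has two elements iff the complement of [A] splits into
    two comparability classes [R1], [R2].  If [l] is a line, these are the two
    sides of [A].

    Conversely, the point is that [A] lies between any [B] in [R1] and [C] in
    [R2].  Otherwise connectedness and extendability yield, for each such [C],
    a first point [M] of [R1] with [A] not in s[C,M], and s[C,M] stays in [R2]
    up to [M].  Applying this three times with the roles of the two classes
    exchanged produces a segment s[M,N] avoiding [A] whose interior lies in both
    [R1] and [R2], which is absurd since connected segments have interior
    points. *)
Require Import Defs.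
From mathcomp Require Import ssreflect ssrfun ssrbool.
From mathcomp Require Import boolp classical_sets.
Set Implicit Arguments.
Unset Strict Implicit.
Unset Printing Implicit Defensive.
Local Open Scope classical_set_scope.

Section Betweenness.
Variables (l : Type) (b : l -> l -> l -> Prop).
Hypothesis hb : is_betweenness b.

(** * Linear order of a segment seen from one of its ends *)

Lemma betl A B : b A A B. Proof. exact: between_endpoint. Qed.

Lemma bet_sym C A B : b C A B -> b C B A. Proof. exact: between_sym. Qed.

Lemma betr A B : b B A B. Proof. exact/bet_sym/betl. Qed.

Lemma bet_id X A : b X A A -> X = A.
Proof.
move=> h; have [_ [_ e]] := seg_split hb (betl A A).
by have : [set A] X by rewrite -e.
Qed.

Lemma bet_split C A B X : b C A B -> b X A B -> b X A C \/ b X C B.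
Proof.
move=> hC hX; have [e _] := seg_split hb hC.
by have : (seg b A C `|` seg b C B) X by rewrite -e.
Qed.

Lemma bet_trans C A B X : b C A B -> b X A C -> b X A B.
Proof.
move=> hC hX; have [e _] := seg_split hb hC.
by have : seg b A B X by rewrite e; left.
Qed.

Lemma bet_meet C A B X : b C A B -> b X A C -> b X C B -> X = C.
Proof.
move=> hC h1 h2; have [_ [e1 e2]] := seg_split hb hC.
by have : [set C] X by rewrite -e2 -e1.
Qed.

Lemma bet_antisym C A B : b C A B -> b B A C -> B = C.
Proof. by move=> h1 h2; apply: (bet_meet h1 h2); exact: betr. Qed.

Lemma bet_shift C A B X : b C A B -> b X A C -> b C X B.
Proof.
move=> hC hX; have hXB := bet_trans hC hX.
have [h|//] := bet_split hXB hC.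
by rewrite (bet_antisym hX h); exact: betl.
Qed.

Definition comparable (A B C : l) : Prop := b B A C \/ b C A B.

Lemma comparable_sym A B C : comparable A B C -> comparable A C B.
Proof. by case; [right|left]. Qed.

Lemma bet_total A B C X : b C A B -> b X A B -> comparable A C X.
Proof.
move=> hC hX; have [h|h] := bet_split hC hX; first by right.
by left; apply/bet_sym/(bet_shift (bet_sym hC))/bet_sym.
Qed.

(** As [X] precedes [Y] seen from [A], s[X,Y] stays within the order interval from [X] to [Y]. The
    two halves of the conclusion serve to show initial and final pieces of a segment convex. *)
Lemma seg_comparable_sub A B X Y Z :
  b X A B -> b Y A B -> b Z X Y -> b X A Y -> b Z A B /\ b X A Z.
Proof.
move=> hX hY hZ hXY.
have hZY : b Z A Y by apply/bet_sym/(bet_trans (bet_sym hXY))/bet_sym.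
split; first exact: bet_trans hY hZY.
exact/bet_sym/(bet_shift (bet_sym hXY))/bet_sym.
Qed.

Lemma seg_sub_origin A B E F : b E A B -> b F A B -> b A E F ->
  A = E \/ A = F.
Proof.
move=> hE hF hA; have [h|h] := bet_total hE hF.
- by left; exact: bet_antisym (bet_sym h) (bet_sym hA).
- by right; exact: bet_antisym (bet_sym h) hA.
Qed.

Lemma seg_convex A B : is_convex b (seg b A B).
Proof.
move=> X Y hX hY Z hZ; have [h|h] := bet_total hX hY.
- by have [] := seg_comparable_sub hX hY hZ h.
- by have [] := seg_comparable_sub hY hX (bet_sym hZ) h.
Qed.

(** An end of s[A,B] cannot be interior to a subsegment, so [A] is an end of [S]. The other end [M]
    is the extreme point wanted later. *)
Lemma closed_segment_origin A B S : is_closed_segment b S ->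
  S `<=` seg b A B -> S A -> exists2 M, b M A B & S = seg b A M.
Proof.
move=> [E [F ->]] hS hA.
have hE : b E A B by apply/hS/betl.
have hF : b F A B by apply/hS/betr.
have [<-|<-] := seg_sub_origin hE hF hA; first by exists F.
by exists E => //; apply/seteqP; split => x /bet_sym.
Qed.

(** * Maximal rays as comparability classes *)

Definition ray (A B : l) : set l := [set C | comparable A B C].

Hypothesis nested : forall A B C : l,
  (seg_interior b A B `&` seg_interior b A C) !=set0 ->
  seg b A B `<=` seg b A C \/ seg b A C `<=` seg b A B.
Hypothesis extension : forall A B : l, A <> B -> exists C D : l,
  seg b A B `<=` seg_interior b C D.
Hypothesis conn : forall S : set l,
  is_closed_segment b S -> connected_segment b S.

Lemma seg_extend A B : A <> B -> exists2 Q, Q <> B & b B A Q.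
Proof.
move=> hAB; have [C [D h]] := extension hAB.
have [hA _] := h _ (betl A B); have [hB nB] := h _ (betr A B).
have [k|k] := bet_split hA hB.
- exists C; last exact: bet_sym.
  by move=> e; apply: nB; left.
- by exists D => // e; apply: nB; right.
Qed.

(** Unless [D] is [B] or [C], it is a common interior point, and [nested] applies. *)
Lemma comparable_common A D B C : D <> A -> b D A B -> b D A C ->
  comparable A B C.
Proof.
move=> hDA hB hC.
have [e|nB] := EM (D = B); first by left; rewrite -e.
have [e|nC] := EM (D = C); first by right; rewrite -e.
have : (seg_interior b A B `&` seg_interior b A C) !=set0.
  by exists D; split; split => // -[].
case/nested => h; [left|right]; apply: h; exact: betr.
Qed.

(** Otherwise s[A,B] would be the disjoint union of two singletons, both of them degenerate closed
    segments, against connectedness. *)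
Lemma seg_dense A B : A <> B -> exists D, [/\ b D A B, D <> A & D <> B].
Proof.
move=> hAB; apply: contrapT => hn.
have [|_ /(_ [set A] [set B])] := @conn (seg b A B); first by exists A, B.
have point_convex X : is_convex b [set X] by move=> x y -> -> z /bet_id.
have point_seg X : is_closed_segment b [set X].
  exists X, X; apply/seteqP; split => x; last exact: bet_id.
  by move=> ->; exact: betl.
case.
- apply/seteqP; split => x; last by case=> ->; [exact: betl|exact: betr].
  move=> hx; apply: contrapT => h; apply: hn; exists x.
  by split => // e; apply: h; [left|right].
- by apply/seteqP; split => x // [/= -> e]; case: hAB.
- by exists A.
- by exists B.
- exact: point_convex.
- exact: point_convex.
- by case=> _; apply; exact: point_seg.
- by case=> + _; apply; exact: point_seg.
Qed.

(** Every point is comparable to [A], so the middle point [B] has to differ from [A]. *)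
Lemma comparable_trans A B C D : B <> A -> comparable A B C ->
  comparable A B D -> comparable A C D.
Proof.
move=> hB [hC|hC] [hD|hD].
- exact: comparable_common hB hC hD.
- by right; exact: bet_trans hC hD.
- by left; exact: bet_trans hD hC.
- exact: bet_total hC hD.
Qed.

Lemma ray_self A B : ray A B B. Proof. by left; exact: betr. Qed.

Lemma origin_in_ray A B : ray A B A. Proof. by right; exact: betl. Qed.

Lemma ray_eq A B C : B <> A -> C <> A -> ray A B C -> ray A B = ray A C.
Proof.
move=> hB hC h; apply/seteqP; split => x hx.
- exact: comparable_trans hB h hx.
- exact: comparable_trans hC (comparable_sym h) hx.
Qed.

Lemma ray_down A B X Y : B <> A -> ray A B X -> b Y A X -> ray A B Y.
Proof.
move=> hB [h|h] hY; first exact: bet_total h hY.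
by right; exact: bet_trans h hY.
Qed.

Lemma ray_up A B X Y : B <> A -> ray A B X -> X <> A -> b X A Y -> ray A B Y.
Proof. by move=> hB h hX hY; rewrite (ray_eq hB hX h); left. Qed.

Lemma ray_unbounded A B F : B <> A -> F <> A -> ray A B F ->
  exists2 Q, ray A B Q & ~ b Q A F.
Proof.
move=> hB hF hBF; have [Q hQ hFQ] := seg_extend (not_eq_sym hF).
exists Q; first exact: ray_up hFQ.
by move=> h; apply: hQ; exact: bet_antisym hFQ h.
Qed.

Lemma ray_directed A B X Y : B <> A -> ray A B X -> ray A B Y ->
  exists W, [/\ ray A B W, b X A W & b Y A W].
Proof.
move=> hB hX hY; have [h|h] := comparable_trans hB hX hY.
- by exists Y; split => //; exact: betr.
- by exists X; split => //; exact: betr.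
Qed.

Lemma ray_is_ray A B : B <> A -> is_ray b A (ray A B).
Proof.
move=> hB; split.
- move=> X Y hX hY Z hZ; have [h|h] := comparable_trans hB hX hY.
  + by have [k _] := seg_comparable_sub h (betr A Y) hZ h; exact: ray_down k.
  + have [k _] := seg_comparable_sub h (betr A X) (bet_sym hZ) h.
    exact: ray_down k.
- exact: origin_in_ray.
- move=> X Y hX hY nX nY hA; have [h|h] := comparable_trans hB hX hY.
  + by apply: nX; apply: bet_antisym (bet_sym hA) (bet_sym h).
  + by apply: nY; apply: bet_antisym hA (bet_sym h).
- move=> X Y Z hX hY hZ.
  have [W [hW XW YW]] := ray_directed hB hX hY.
  have [T [hT WT ZT]] := ray_directed hB hW hZ.
  exists A, T; split; last by move=> x; exact: ray_down.
  by move=> x [[]|] ->; [exact: bet_trans WT XW|exact: bet_trans WT YW|].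
(* A ray equal to s[E,F] would lie in some s[A,W], hence be s[A,M] for some [M]; but extending
   beyond [M] does not leave the ray. *)
- case=> E [F e].
  have rE : ray A B E by rewrite e; exact: betl.
  have rF : ray A B F by rewrite e; exact: betr.
  have [W [hW EW FW]] := ray_directed hB rE rF.
  have [|||M hM eM] := @closed_segment_origin A W (ray A B).
  + by exists E, F.
  + by rewrite e; exact: seg_convex.
  + exact: origin_in_ray.
  have rM : ray A B M by rewrite eM; exact: betr.
  have [nM|nM] := EM (M = A).
  + by have := ray_self A B; rewrite eM nM => /bet_id.
  + have [Q] := ray_unbounded hB nM rM.
    by rewrite eM.
Qed.

(** The origin is not between two other points of [r], so it is an end of any segment of [r]
    containing it; points of such a segment are comparable. *)
Lemma ray_sub A B r : is_ray b A r -> r B -> B <> A -> r `<=` ray A B.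
Proof.
move=> hr rB hB C rC.
have [E [F [h1 h2]]] := ray_three_points hr (ray_origin hr) rB rC.
have hA : b A E F by apply: h1; left; left.
have hBE : b B E F by apply: h1; left; right.
have hCE : b C E F by apply: h1; right.
have [eE|nE] := EM (E = A).
  by rewrite eE in hBE hCE; exact: bet_total hBE hCE.
have [eF|nF] := EM (F = A).
  by rewrite eF in hBE hCE; exact: bet_total (bet_sym hBE) (bet_sym hCE).
by case: (ray_origin_extreme hr (h2 _ (betl E F)) (h2 _ (betr E F)) nE nF).
Qed.

Lemma ray_in_boundary A B : B <> A -> boundary_at_infinity b A (ray A B).
Proof.
move=> hB; split; last by move=> S hS _; exact: conn.
split; first exact: ray_is_ray.
move=> r hr [h1]; apply; apply: ray_sub => //; exact/h1/ray_self.
Qed.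

Lemma boundary_ray A r : boundary_at_infinity b A r ->
  exists2 B, B <> A & r = ray A B.
Proof.
move=> [[hr hmax] _].
(* Without a second point, [r] would be the degenerate segment s[A,A]. *)
have [B rB hB] : exists2 B, r B & B <> A.
  apply: contrapT => h; apply: (ray_not_segment hr); exists A, A.
  apply/seteqP; split => x.
  - move=> rx; rewrite (_ : x = A); first exact: betl.
    by apply: contrapT => nx; apply: h; exists x.
  - by move=> /bet_id ->; exact: ray_origin hr.
exists B => //; apply: contrapT => h; apply: (hmax _ (ray_is_ray hB)).
have hsub := ray_sub hr rB hB.
by split => // h'; apply: h; apply/seteqP.
Qed.

(** * The two ends of a line *)

Lemma line_two_ends : is_line b -> exists (A : l) (r1 r2 : set l),
  r1 <> r2 /\ boundary_at_infinity b A = [set r1; r2].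
Proof.
move=> [_ [A _] /(_ A)[c1 [c2 [e [e0 [[B hB] [[C hC] [v1 [v2 hA]]]]]]]]].
have n1 x : c1 x -> x <> A.
  by move=> h; have : (~` [set A]) x by rewrite e; left.
have n2 x : c2 x -> x <> A.
  by move=> h; have : (~` [set A]) x by rewrite e; right.
(* Two points of one side both have [A] between them and a point of the other
   side, so nesting makes them comparable. *)
have side X Y Z : X <> A -> Y <> A -> ~ b A X Y -> Z <> A ->
    b A Z X -> b A Z Y -> comparable A X Y.
  move=> nX nY hn nZ hX hY.
  have [h|h] := comparable_common (not_eq_sym nZ) hX hY.
  - have [k|k] := bet_split hY h; last by left.
    by case: nX; exact: bet_antisym hX k.
  - have [k|k] := bet_split hX h; last by right.
    by case: nY; exact: bet_antisym hY k.
exists A, (ray A B), (ray A C); split.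
  move=> h; have : ray A B C by rewrite h; exact: ray_self.
  have hBC := hA _ _ hB hC.
  case=> k.
  - by apply: (n1 _ hB); exact: bet_antisym (bet_sym hBC) (bet_sym k).
  - by apply: (n2 _ hC); exact: bet_antisym hBC (bet_sym k).
apply/seteqP; split => r; last first.
  by case=> ->; apply: ray_in_boundary; [exact: n1|exact: n2].
move=> /boundary_ray[D nD ->].
(* [D] is comparable to the chosen point of its side: convexity keeps [A] out of the segment joining
   them, and the chosen point of the other side serves as [Z] in [side]. *)
have : (c1 `|` c2) D by rewrite -e.
case=> hD; [left|right]; apply/esym/ray_eq => //.
- exact: n1.
- apply: (@side _ _ C); [exact: n1|exact: n1| |exact: n2| |].
  + by move=> /(v1 _ _ hB hD)/n1.
  + exact/bet_sym/hA.
  + exact/bet_sym/hA.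
- exact: n2.
- apply: (@side _ _ B); [exact: n2|exact: n2| |exact: n1| |].
  + by move=> /(v2 _ _ hC hD)/n2.
  + exact: hA.
  + exact: hA.
Qed.

(** * Two rays covering the space are separated by their origin *)

Definition two_rays (A P Q : l) : Prop :=
  [/\ P <> A, Q <> A, forall x, ray A P x \/ ray A Q x &
      forall x, ray A P x -> ray A Q x -> x = A].

Lemma two_rays_sym A P Q : two_rays A P Q -> two_rays A Q P.
Proof.
move=> [hP hQ hc hd]; split => // x; first by have [] := hc x; [right|left].
by move=> h1 h2; exact: hd.
Qed.

(* [M] is the first point of [ray A P] that [A] does not separate from [C]. *)
Definition first_gap (A P Q C M : l) : Prop :=
  [/\ ray A P M, M <> A, ~ b A C M,
      forall Z, b Z M C -> Z <> M -> ray A Q Z &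
      forall Z, b Z A M -> Z <> M -> b A C Z].

(** Seen from [A], the set [S] is closed downwards, so it cuts s[A,B] into two convex pieces,
    exactly one of which is closed. Extendability rules out the lower one, so the upper one has a
    first point. *)
Lemma first_gap_exists A P Q B C : two_rays A P Q -> ray A P B ->
  ray A Q C -> C <> A -> ~ b A C B -> exists M, first_gap A P Q C M.
Proof.
move=> [hP hQ hcov hdisj] rB rC nC nB.
pose S := [set Z | b A C Z].
have S_down Y Z : S Y -> b Z A Y -> S Z.
  by move=> hY hZ; apply/bet_sym/(bet_shift (bet_sym hY))/bet_sym.
(* [A] is extreme in [ray A Q], so that ray cannot continue from [C] past [A]. *)
have beyond Z : b A C Z -> Z <> A -> ray A P Z.
  move=> hZ nZ; have [//|rZ] := hcov Z.
  by case: (ray_origin_extreme (ray_is_ray hQ) rC rZ nC nZ).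
have S_bounded Z : S Z -> ray A P Z -> b Z A B.
  move=> hZ rZ; have [//|k] := comparable_trans hP rZ rB.
  by case: nB; exact: S_down hZ k.
pose X := seg b A B `&` S; pose Y := seg b A B `&` ~` S.
have [_ /(_ X Y)] : connected_segment b (seg b A B) by apply: conn; exists A, B.
case.
- apply/seteqP; split => x; last by case=> -[].
  by move=> hx; have [|] := EM (S x); [left|right].
- by apply/seteqP; split => x // [[_ h1] [_ h2]].
- by exists A; split; [exact: betl|exact: betr].
- by exists B; split; [exact: betr|].
- move=> U V [hU SU] [hV SV] Z hZ; split; first exact: seg_convex hU hV _ hZ.
  have [h|h] := bet_total hU hV.
  + by have [k _] := seg_comparable_sub h (betr A V) hZ h; exact: S_down k.
  + have [k _] := seg_comparable_sub h (betr A U) (bet_sym hZ) h.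
    exact: S_down k.
- move=> U V [hU SU] [hV SV] Z hZ; split; first exact: seg_convex hU hV _ hZ.
  move=> SZ; have [h|h] := bet_total hU hV.
  + by have [_ k] := seg_comparable_sub hU hV hZ h; apply/SU/(S_down _ _ SZ).
  + have [_ k] := seg_comparable_sub hV hU (bet_sym hZ) h.
    by apply/SV/(S_down _ _ SZ).
- move=> [hX _].
  (* If [A] separated [C] from a last point [M], extending s[C,M] beyond [M]
     would produce a later one. *)
  have [||M hM eM] := @closed_segment_origin A B X hX.
  + by move=> x [].
  + by split; [exact: betl|exact: betr].
  have SM : S M by have : X M; [rewrite eM; exact: betr|case].
  have max Z : S Z -> ray A P Z -> b Z A M.
    move=> SZ rZ; have : X Z by split => //; exact: S_bounded.
    by rewrite eM.
  have nCM : C <> M.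
    by move=> e; apply: nC; move: SM; rewrite /S /= -e => /bet_id.
  have [T nT hMT] := seg_extend nCM.
  have ST : S T by exact: bet_trans hMT SM.
  have hAMT : b M A T by exact: bet_shift hMT SM.
  have nTA : T <> A.
    by move=> e; apply: nT; rewrite e in hAMT *; rewrite -(bet_id hAMT).
  case: nT; apply: bet_antisym hAMT _; apply: max => //; exact: beyond.
- move=> [_ hY].
  (* [Y] contains [B], so it is read from that end; [M] is its point nearest to [A]. *)
  have [|||M hM eM] := @closed_segment_origin B A Y.
  + by [].
  + by move=> x [/bet_sym].
  + by split; [exact: betr|].
  have [hMB SM] : Y M by rewrite eM; exact: betr.
  have rM : ray A P M := ray_down hP rB hMB.
  have nM : M <> A by move=> e; apply: SM; rewrite e; exact: betr.
  have Sbelow Z : b Z A M -> Z <> M -> S Z.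
    move=> hZ nZ; apply: contrapT => nS.
    have : Y Z by split => //; exact: bet_trans hMB hZ.
    by rewrite eM => /bet_sym h; apply: nZ; exact: bet_meet hMB hZ h.
  have nMQ : ~ ray A Q M by move=> h; apply: nM; exact: hdisj.
  have nCM : C <> M by move=> e; apply: nMQ; rewrite -e.
  exists M; split => // Z hZ nZ.
  (* Suppose [Z] is on [ray A P] and extend s[C,M] to [T], so that [M] is between [Z] and [T].
     Neither [Z] nor [T] can precede [M] seen from [A]; being comparable, one of them then lies
     between [M] and the other, a contradiction. *)
  have [rZ|//] := hcov Z; exfalso.
  have [T nT hMT] := seg_extend nCM.
  have hMZT : b M Z T by apply: bet_shift hMT _; exact: bet_sym.
  have rT : ray A P T.
    have [//|rT] := hcov T.
    by case: nMQ; apply: (ray_convex (ray_is_ray hQ) rC rT).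
  have [k|hMZ] := comparable_trans hP rZ rM.
    by apply: SM; exact: bet_trans (bet_sym hZ) (Sbelow _ k nZ).
  have [k|hAMT] := comparable_trans hP rT rM.
    have [k1|k1] := bet_split (Sbelow _ k nT) hMT.
      by apply: nMQ; exact: ray_down rC (bet_sym k1).
    by apply: nT; exact: bet_antisym k1 k.
  have [k|k] := comparable_trans hP rZ rT.
  + by apply: nZ; exact: bet_antisym (bet_sym hMZT) (bet_sym (bet_shift k hMZ)).
  + by apply: nT; exact: bet_antisym hMZT (bet_sym (bet_shift k hAMT)).
Qed.

Lemma two_rays_separated A P Q B C : two_rays A P Q -> ray A P B ->
  ray A Q C -> b A B C.
Proof.
move=> hPQ rB rC; have hQP := two_rays_sym hPQ.
have [_ _ _ hdisj] := hPQ.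
have [->|nC] := EM (C = A); first exact: betr.
apply: contrapT => nBC.
have nCB : ~ b A C B by move/bet_sym.
have [M [rM nM gCM _ belowM]] := first_gap_exists hPQ rB rC nC nCB.
have nMC : ~ b A M C by move/bet_sym.
have [N [rN nN gMN NM_P belowN]] := first_gap_exists hQP rC rM nM nMC.
have nNM : ~ b A N M by move/bet_sym.
have [M' [rM' nM' gNM' M'N_Q belowM']] := first_gap_exists hPQ rM rN nN nNM.
have [hP hQ _ _] := hPQ.
(* If [C] came strictly before [N], then [belowN] would put [A] in s[M,C]. The same argument places
   [M'] before [M]. *)
have NC : b N A C.
  have [//|k] := comparable_trans hQ rN rC.
  have [<-|n] := EM (C = N); first exact: betr.
  by case: nMC; exact: belowN.
have M'M : b M' A M.
  have [//|k] := comparable_trans hP rM' rM.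
  have [<-|n] := EM (M = M'); first exact: betr.
  by case: nNM; exact: belowM'.
(* If [M'] came strictly before [M], then [A] would be in s[C,M'], hence in s[N,M'] because [N] is
   in s[A,C]. *)
have eM : M' = M.
  apply: contrapT => n; apply: gNM'.
  exact: bet_shift (belowM _ M'M n) (bet_sym NC).
rewrite eM in M'N_Q.
have nMN : M <> N.
  by move=> e; apply: nM; apply: hdisj => //; rewrite e.
have [E [hE nEM nEN]] := seg_dense nMN.
have eA : E = A.
  by apply: hdisj; [apply: NM_P => //; exact: bet_sym|exact: M'N_Q].
by apply: gMN; rewrite -eA.
Qed.

(** * From two rays to a separation at every point *)

Lemma separated_side_convex X (c1 c2 : set l) :
  ~` [set X] = c1 `|` c2 -> c1 !=set0 ->
  (forall B C, c1 B -> c2 C -> b X B C) -> is_convex b c2.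
Proof.
move=> e [W hW] sep.
have n1 x : c1 x -> x <> X.
  by move=> h; have : (~` [set X]) x by rewrite e; left.
have n2 x : c2 x -> x <> X.
  by move=> h; have : (~` [set X]) x by rewrite e; right.
(* Seen from [W], both [U] and [V] lie beyond [X] and are comparable, so [X] is not in s[U,V]. If
   [Z] were in [c1], then [X] would be in both s[Z,U] and s[Z,V], which meet only in [Z]. *)
move=> U V hU hV Z hZ.
have nZX : Z <> X.
  move=> eZ; rewrite {Z}eZ in hZ.
  have [h|h] := comparable_common
    (not_eq_sym (n1 _ hW)) (sep _ _ hW hU) (sep _ _ hW hV).
  - apply: (n2 _ hU); apply: bet_antisym (bet_sym hZ) _.
    exact/bet_sym/(bet_shift h)/(sep _ _ hW hU).
  - apply: (n2 _ hV); apply: bet_antisym hZ _.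
    exact/bet_sym/(bet_shift h)/(sep _ _ hW hV).
have : (c1 `|` c2) Z by rewrite -e.
case=> // h; case: nZX; apply/esym.
exact: bet_meet hZ (bet_sym (sep _ _ h hU)) (sep _ _ h hV).
Qed.

(** One side of [X] is what lies beyond it on its ray, the other is everything else. From beyond
    [X], the other ray is reached only through [A], and [A] only through [X]. *)
Lemma two_rays_separation A P Q X : two_rays A P Q -> ray A P X ->
  exists c1 c2 : set l,
    ~` [set X] = c1 `|` c2 /\ c1 `&` c2 = set0 /\
    c1 !=set0 /\ c2 !=set0 /\ is_convex b c1 /\ is_convex b c2 /\
    forall B C : l, c1 B -> c2 C -> b X B C.
Proof.
move=> hPQ rX; have [hP hQ hcov hdisj] := hPQ.
pose c1 := [set Z | ray A P Z /\ ~ b Z A X].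
pose c2 := [set Z | (ray A Q Z \/ b Z A X) /\ Z <> X].
have e : ~` [set X] = c1 `|` c2.
  apply/seteqP; split => Z.
  - move=> nZ; have [h|h] := EM (b Z A X); first by right; split => //; right.
    by have [r|r] := hcov Z; [left|right; split => //; left].
  - by case=> [[_ h] eZ|[]//]; apply: h; rewrite eZ; exact: betr.
have c1_nonempty : c1 !=set0.
  have [eX|nX] := EM (X = A); last first.
    by have [Z] := ray_unbounded hP nX rX; exists Z.
  by exists P; split; [exact: ray_self|rewrite eX => /bet_id].
have c2_nonempty : c2 !=set0.
  have [eX|nX] := EM (X = A).
    by exists Q; split; [left; exact: ray_self|rewrite eX].
  by exists A; split; [left; exact: origin_in_ray|exact: not_eq_sym].
have sep B C : c1 B -> c2 C -> b X B C.
  move=> [rB nB] [hC _].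
  have hX : b X A B by have [|] := comparable_trans hP rB rX.
  case: hC => [rC|hC]; last exact/bet_sym/(bet_shift hX).
  exact: bet_trans (two_rays_separated hPQ rB rC) (bet_sym hX).
exists c1, c2; split => //; split; last split => //; last split => //.
  apply/seteqP; split => Z // [[rZ nZ] [[h|//] _]]; apply: nZ.
  by rewrite (hdisj _ rZ h); exact: betl.
split; last by split => //; exact: separated_side_convex e c1_nonempty sep.
apply: (@separated_side_convex X c2 c1) => //; first by rewrite setUC.
by move=> B C hB hC; exact/bet_sym/sep.
Qed.

(** Each [x] other than [A] spans a maximal ray, which must be [r1] or [r2]; if [x] were on both,
    they would coincide. *)
Lemma boundary_two_rays A r1 r2 : r1 <> r2 ->
  boundary_at_infinity b A = [set r1; r2] -> exists P Q, two_rays A P Q.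
Proof.
move=> hr e.
have [P hP eP] : exists2 B, B <> A & r1 = ray A B.
  by apply: boundary_ray; rewrite e; left.
have [Q hQ eQ] : exists2 B, B <> A & r2 = ray A B.
  by apply: boundary_ray; rewrite e; right.
exists P, Q; split => // x.
- have [->|nx] := EM (x = A); first by left; exact: origin_in_ray.
  have := ray_in_boundary nx; rewrite e => -[/= k|/= k].
  + by left; rewrite -eP -k; exact: ray_self.
  + by right; rewrite -eQ -k; exact: ray_self.
- move=> h1 h2; apply: contrapT => nx; apply: hr.
  by rewrite eP eQ (ray_eq hP nx h1) (ray_eq hQ nx h2).
Qed.

Lemma two_rays_line A P Q : two_rays A P Q -> is_line b.
Proof.
move=> h; have [hP _ hcov _] := h; split => //; first by exists P, A.
move=> X; have [r|r] := hcov X; first exact: two_rays_separation h r.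
exact: two_rays_separation (two_rays_sym h) r.
Qed.

End Betweenness.

Theorem theorem6p12 (l : Type) (between : l -> l -> l -> Prop)
    (hl : is_pasch_space between)
    (hconn : forall S : set l,
       is_closed_segment between S -> connected_segment between S) :
  is_line between <->
  exists (A : l) (r1 r2 : set l),
    r1 <> r2 /\ boundary_at_infinity between A = [set r1; r2].
Proof.
have [[hb nested ext] _] := hl.
(* All segments being connected, every nondegenerate one can be extended. *)
have extension A B : A <> B ->
    exists C D : l, seg between A B `<=` seg_interior between C D.
  move=> hAB; have [|C [D [_ h]]] := ext _ _ hAB; last by exists C, D.
  by apply: hconn; exists A, B.
split; first exact: line_two_ends.
move=> [A [r1 [r2 [hr e]]]].
have [P [Q h]] := boundary_two_rays hb nested extension hconn hr e.
exact: two_rays_line h.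
Qed.
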